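(* Let $\mathcal{A}$ denote the class of all groups isomorphic to subgroups of (finitely generated) right angled Artin groups. Suppose that $F \in \mathcal{A}$ and $N \lhd F$ is a normal subgroup such that $F/N \in \mathcal{A}$. Let $G$ be the special HNN-extension of $F$ with respect to $N$, i.e. $G=\langle F,t \mid tht^{-1}=h \text{ for all } h \in N \rangle$. Then: (i) $G \in \mathcal{A}$; (ii) if $A$ is any right angled Artin group such that $G$ can be isomorphically embedded into $A$, then $F/N$ can be isomorphically embedded into $A$.
   Context: Given a finite simplicial graph $\Gamma$ with vertex set $V\Gamma$ and edge set $E\Gamma$, the associated right angled Artin group is $A(\Gamma)=\langle V\Gamma \mid [u,v]=1 \text{ for all } \{u,v\}\in E\Gamma\rangle$; all right angled Artin groups are associated to finite graphs. The presentation of $G$ is relative: $G$ is the quotient of the free product $F * \langle t\rangle$, with $\langle t\rangle$ infinite cyclic, by the normal closure of the elements $tht^{-1}h^{-1}$, $h \in N$. *)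

(* Defs.v *)
From HB Require Import structures.
From mathcomp Require Import all_boot ssralg ssrint.
From mathcomp Require Import boolp classical_sets functions.

Set Implicit Arguments.
Unset Strict Implicit.
Unset Printing Implicit Defensive.

Local Open Scope classical_set_scope.
Local Open Scope group_scope.
Local Open Scope quotient_scope.

(* MathComp's group_closed is about boolean predicates; the following is its
   counterpart for classical sets. *)
Definition is_subgroup (G : groupType) (H : set G) : Prop :=
  H 1 /\ (forall x y, H x -> H y -> H (x / y)).

Definition is_normal (G : groupType) (N : set G) : Prop :=
  is_subgroup N /\ (forall x g, N x -> N (x ^ g)).

Record normal_subgroup (G : groupType) := NormalSubgroup {
  normal_set : set G;
  normal_setP : is_normal normal_set
}.

Definition isomorphic_to_subgroup (G A : groupType) : Prop :=
  exists S : set A, is_subgroup S /\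
    exists f : {multiplicative G -> A}, set_bij [set: G] S f.

Definition embeds (G A : groupType) : Prop :=
  exists f : {multiplicative G -> A}, injective f.

Section Quotient.
Context (G : groupType) (N : normal_subgroup G).

Lemma normal1 : normal_set N 1.
Proof. by case: (normal_setP N) => -[]. Qed.

Lemma normalF x y : normal_set N x -> normal_set N y -> normal_set N (x / y).
Proof. by case: (normal_setP N) => -[_ +] _; exact. Qed.

Lemma normalJ x g : normal_set N x -> normal_set N (x ^ g).
Proof. by case: (normal_setP N) => _; exact. Qed.

Lemma normalV x : normal_set N x -> normal_set N x^-1.
Proof. by move=> Nx; rewrite -[x^-1]mul1g; exact: normalF normal1 Nx. Qed.

Lemma normalM x y : normal_set N x -> normal_set N y -> normal_set N (x * y).
Proof. by move=> Nx Ny; rewrite -[y]invgK; exact: normalF (normalV Ny). Qed.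

Definition coset_rel : rel G := fun x y => `[< normal_set N (x^-1 * y) >].

Lemma coset_rel_refl : reflexive coset_rel.
Proof. by move=> x; apply/asboolP; rewrite mulVg; exact: normal1. Qed.

Lemma coset_rel_sym : symmetric coset_rel.
Proof.
by move=> x y; apply/asboolP/asboolP => /normalV; rewrite invgM invgK.
Qed.

Lemma coset_rel_trans : transitive coset_rel.
Proof.
move=> y x z /asboolP xy /asboolP yz; apply/asboolP.
by have := normalM xy yz; rewrite mulgA mulgK.
Qed.

Canonical coset_equiv : equiv_rel G :=
  EquivRel coset_rel coset_rel_refl coset_rel_sym coset_rel_trans.

Definition quotient_group : Type := {eq_quot coset_equiv}.

HB.instance Definition _ := Choice.on quotient_group.

Definition coset (x : G) : quotient_group := \pi_({eq_quot coset_equiv}) x.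

Definition quotient_one : quotient_group := coset 1.
Definition quotient_inv (x : quotient_group) : quotient_group :=
  coset (repr x)^-1.
Definition quotient_mul (x y : quotient_group) : quotient_group :=
  coset (repr x * repr y).

Lemma coset_eq x y : coset x = coset y <-> normal_set N (x^-1 * y).
Proof. by split=> [/eqmodP/asboolP|H]; last exact/eqmodP/asboolP. Qed.

Lemma coset_repr x : coset (repr x) = x.
Proof. exact: reprK. Qed.

Lemma quotient_mulE x y : quotient_mul (coset x) (coset y) = coset (x * y).
Proof.
apply/coset_eq; set x' := repr _; set y' := repr _.
have Nx : normal_set N (x'^-1 * x) by apply/coset_eq; rewrite coset_repr.
have Ny : normal_set N (y'^-1 * y) by apply/coset_eq; rewrite coset_repr.
have -> : (x' * y')^-1 * (x * y) = (x'^-1 * x) ^ y' * (y'^-1 * y).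
  by rewrite /conjg invgM !mulgA mulgK.
exact: normalM (normalJ _ Nx) Ny.
Qed.

Lemma quotient_invE x : quotient_inv (coset x) = coset x^-1.
Proof.
apply/coset_eq; set x' := repr _.
have Nx : normal_set N (x'^-1 * x) by apply/coset_eq; rewrite coset_repr.
have -> : (x'^-1)^-1 * x^-1 = (x'^-1 * x)^-1 ^ x'^-1.
  by rewrite /conjg invgM !invgK mulgK.
exact: normalJ (normalV Nx).
Qed.

Lemma quotient_mulA : associative quotient_mul.
Proof.
move=> x y z; rewrite -(coset_repr x) -(coset_repr y) -(coset_repr z).
by rewrite !quotient_mulE mulgA.
Qed.

Lemma quotient_mul1 : left_id quotient_one quotient_mul.
Proof. by move=> x; rewrite -(coset_repr x) quotient_mulE mul1g. Qed.

Lemma quotient_mulr1 : right_id quotient_one quotient_mul.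
Proof. by move=> x; rewrite -(coset_repr x) quotient_mulE mulg1. Qed.

Lemma quotient_mulV : left_inverse quotient_one quotient_inv quotient_mul.
Proof.
by move=> x; rewrite -(coset_repr x) quotient_invE quotient_mulE mulVg.
Qed.

Lemma quotient_mulrV : right_inverse quotient_one quotient_inv quotient_mul.
Proof.
by move=> x; rewrite -(coset_repr x) quotient_invE quotient_mulE mulgV.
Qed.

HB.instance Definition _ := isGroup.Build quotient_group
  quotient_mulA quotient_mul1 quotient_mulr1 quotient_mulV quotient_mulrV.

Lemma cosetM : {morph coset : x y / x * y}.
Proof. by move=> x y; rewrite -quotient_mulE. Qed.

HB.instance Definition _ := isMultiplicative.Build G quotient_group coset cosetM.

End Quotient.

Arguments coset {G} N x.

Section NormalClosure.
Context (G : groupType) (R : set G).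

Lemma normal_closure_subproof : is_normal (smallest (@is_normal G) R).
Proof.
split; [split=> [K [[[K1 _] _] _] //|x y Hx Hy K HK]|move=> x g Hx K HK].
  by case: (HK) => -[[_ KF] _] _; apply: KF; [exact: Hx|exact: Hy].
by case: (HK) => -[_ KJ] _; apply: KJ; exact: Hx.
Qed.

Definition normal_closure : normal_subgroup G :=
  NormalSubgroup normal_closure_subproof.

End NormalClosure.

(* A letter (x, true) stands for x and (x, false) for its formal inverse. *)
Inductive word_equiv (X : Type) : seq (X * bool) -> seq (X * bool) -> Prop :=
| word_equiv_refl u : word_equiv u u
| word_equiv_sym u v : word_equiv u v -> word_equiv v u
| word_equiv_trans u v w : word_equiv u v -> word_equiv v w -> word_equiv u w
| word_equiv_cancel u x b v :
    word_equiv (u ++ (x, b) :: (x, ~~ b) :: v) (u ++ v).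

Section FreeGroup.
Context (X : choiceType).
Implicit Types u v w : seq (X * bool).

Definition word_inv w : seq (X * bool) := rev [seq (a.1, ~~ a.2) | a <- w].

Lemma word_equiv_catl w u v :
  word_equiv u v -> word_equiv (w ++ u) (w ++ v).
Proof.
elim=> {u v} [u|u v _ IH|u v t _ IH1 _ IH2|u x b v].
- exact: word_equiv_refl.
- exact: word_equiv_sym.
- exact: word_equiv_trans IH1 IH2.
- by rewrite !catA; exact: word_equiv_cancel.
Qed.

Lemma word_equiv_catr w u v :
  word_equiv u v -> word_equiv (u ++ w) (v ++ w).
Proof.
elim=> {u v} [u|u v _ IH|u v t _ IH1 _ IH2|u x b v].
- exact: word_equiv_refl.
- exact: word_equiv_sym.
- exact: word_equiv_trans IH1 IH2.
- by rewrite -!catA !cat_cons; exact: word_equiv_cancel.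
Qed.

Lemma word_equiv_cat u u' v v' :
  word_equiv u u' -> word_equiv v v' -> word_equiv (u ++ v) (u' ++ v').
Proof.
by move=> /(word_equiv_catr v) H /(word_equiv_catl u'); exact: word_equiv_trans.
Qed.

Lemma word_equiv_inv u v :
  word_equiv u v -> word_equiv (word_inv u) (word_inv v).
Proof.
elim=> {u v} [u|u v _ IH|u v t _ IH1 _ IH2|u x b v].
- exact: word_equiv_refl.
- exact: word_equiv_sym.
- exact: word_equiv_trans IH1 IH2.
- rewrite /word_inv !map_cat !rev_cat /= !rev_cons -!cats1 -!catA /= negbK.
  exact: word_equiv_cancel.
Qed.

Lemma word_equiv_mulV w : word_equiv (word_inv w ++ w) [::].
Proof.
elim: w => [|[x b] w IH]; first exact: word_equiv_refl.
rewrite /word_inv /= rev_cons -cats1 -catA /=.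
have := word_equiv_cancel (word_inv w) x (~~ b) w.
by rewrite negbK => /word_equiv_trans; apply.
Qed.

Lemma word_equiv_mulrV w : word_equiv (w ++ word_inv w) [::].
Proof.
have invK : word_inv (word_inv w) = w.
  rewrite /word_inv map_rev revK -map_comp map_id_in // => -[x b] _ /=.
  by rewrite negbK.
by rewrite -{1}invK; exact: word_equiv_mulV.
Qed.

Definition word_rel : rel (seq (X * bool)) := fun u v => `[< word_equiv u v >].

Lemma word_rel_refl : reflexive word_rel.
Proof. by move=> u; exact/asboolP/word_equiv_refl. Qed.

Lemma word_rel_sym : symmetric word_rel.
Proof. by move=> u v; apply/asboolP/asboolP => /word_equiv_sym. Qed.

Lemma word_rel_trans : transitive word_rel.
Proof.
move=> v u w /asboolP uv /asboolP vw; apply/asboolP.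
exact: word_equiv_trans uv vw.
Qed.

Canonical word_rel_equiv : equiv_rel (seq (X * bool)) :=
  EquivRel word_rel word_rel_refl word_rel_sym word_rel_trans.

Definition free_group : Type := {eq_quot word_rel_equiv}.

HB.instance Definition _ := Choice.on free_group.

Definition word_class (w : seq (X * bool)) : free_group :=
  \pi_({eq_quot word_rel_equiv}) w.

Definition free_one : free_group := word_class [::].
Definition free_inv (x : free_group) : free_group :=
  word_class (word_inv (repr x)).
Definition free_mul (x y : free_group) : free_group :=
  word_class (repr x ++ repr y).

Lemma word_class_eq u v : word_class u = word_class v <-> word_equiv u v.
Proof. by split=> [/eqmodP/asboolP|H]; last exact/eqmodP/asboolP. Qed.

Lemma word_class_repr x : word_class (repr x) = x.
Proof. exact: reprK. Qed.

Lemma repr_word_class u : word_equiv (repr (word_class u)) u.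
Proof. by apply/word_class_eq; rewrite word_class_repr. Qed.

Lemma free_mulE u v :
  free_mul (word_class u) (word_class v) = word_class (u ++ v).
Proof. by apply/word_class_eq/word_equiv_cat; exact: repr_word_class. Qed.

Lemma free_invE u : free_inv (word_class u) = word_class (word_inv u).
Proof. by apply/word_class_eq/word_equiv_inv; exact: repr_word_class. Qed.

Lemma free_mulA : associative free_mul.
Proof.
move=> x y z.
rewrite -(word_class_repr x) -(word_class_repr y) -(word_class_repr z).
by rewrite !free_mulE catA.
Qed.

Lemma free_mul1 : left_id free_one free_mul.
Proof. by move=> x; rewrite -(word_class_repr x) free_mulE. Qed.

Lemma free_mulr1 : right_id free_one free_mul.
Proof. by move=> x; rewrite -(word_class_repr x) free_mulE cats0. Qed.

Lemma free_mulV : left_inverse free_one free_inv free_mul.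
Proof.
move=> x; rewrite -(word_class_repr x) free_invE free_mulE.
exact/word_class_eq/word_equiv_mulV.
Qed.

Lemma free_mulrV : right_inverse free_one free_inv free_mul.
Proof.
move=> x; rewrite -(word_class_repr x) free_invE free_mulE.
exact/word_class_eq/word_equiv_mulrV.
Qed.

HB.instance Definition _ := isGroup.Build free_group
  free_mulA free_mul1 free_mulr1 free_mulV free_mulrV.

Definition free_gen (x : X) : free_group := word_class [:: (x, true)].

End FreeGroup.

Definition presented (X : choiceType) (R : set (free_group X)) : groupType :=
  quotient_group (normal_closure R).

Definition presented_gen (X : choiceType) (R : set (free_group X)) (x : X) :
  presented R := coset (normal_closure R) (free_gen x).

Record simplicial_graph := SimplicialGraph {
  vertex :> finType;
  edge : rel vertex;
  edge_sym : symmetric edge;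
  edge_irrefl : irreflexive edge
}.

Definition raag (Gamma : simplicial_graph) : groupType :=
  presented [set r : free_group (vertex Gamma) |
    exists u v : Gamma, edge u v /\ r = [~ free_gen u, free_gen v]].

Definition in_class_A (G : groupType) : Prop :=
  exists Gamma : simplicial_graph, isomorphic_to_subgroup G (raag Gamma).

(* The free product G * H is presented by the disjoint union of the underlying
   sets of G and H, subject to the multiplication tables of G and of H. *)
Section FreeProduct.
Context (G H : groupType).

Definition free_product_relators : set (free_group (G + H)%type) :=
  [set r | (exists a b : G, r =
              free_gen (inl a) * free_gen (inl b) / free_gen (inl (a * b))) \/
           (exists a b : H, r =
              free_gen (inr a) * free_gen (inr b) / free_gen (inr (a * b)))].

Definition free_product : groupType := presented free_product_relators.

Definition free_product_inl (a : G) : free_product :=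
  presented_gen free_product_relators (inl a).
Definition free_product_inr (b : H) : free_product :=
  presented_gen free_product_relators (inr b).

End FreeProduct.

Definition infinite_cyclic : groupType := Algebra.to_multiplicative int.

Definition infinite_cyclic_gen : infinite_cyclic := (1%R : int).

Section SpecialHNN.
Context (F : groupType) (N : normal_subgroup F).

Definition hnn_letter : free_product F infinite_cyclic :=
  free_product_inr F infinite_cyclic_gen.

Definition hnn_base (h : F) : free_product F infinite_cyclic :=
  free_product_inl infinite_cyclic h.

Definition special_hnn : groupType := quotient_group (normal_closure
  [set r | exists h : F, normal_set N h /\
     r = hnn_letter * hnn_base h * hnn_letter^-1 * (hnn_base h)^-1]).

End SpecialHNN.

(* Main.v *)
Require Import Defs.
From mathcomp Require Import all_boot.
From HB Require Import structures.
From mathcomp Require Import ssralg ssrint zify.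
From mathcomp Require Import boolp classical_sets functions.

(** Both parts rest on one description of a special HNN extension E of H along C,
    given by its universal property (is_hnn): the group E is H with a new letter
    v commuting with C. It acts on streams of letters (hC, +1 or -1), that is, on
    finite and infinite reduced words in the free group on the cosets of C: an
    element of H translates all cosets, and v prepends (C, +1) or cancels
    (C, -1). This stands in for the action on the Bass-Serre tree. Following the
    empty stream shows that a nonempty reduced word in H and v is not 1
    (hnn_normal_form). The group G of the theorem is such an extension of F along
    N, and A(Gamma) is one of A(Gamma - v) along the subgroup generated by the
    neighbours of v (delete_vertex_is_hnn).

    Part (i). Let phi embed F into A(Gamma1) and psi embed F/N into A(Gamma2),
    and let Gamma be the join of Gamma1 with the disjoint union of Gamma2 and one
    vertex t. Map x in F to phi(x) psi(xN), and the letter t to the vertex t.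
    Elements of N go into A(Gamma1), which commutes with t, so this defines a map
    on G. An element of F goes into the subgroup generated by the neighbours of t
    only if psi(xN) = 1, that is, only if x is in N. So reduced words go to
    reduced words and the map is injective.

    Part (ii). If N = F there is nothing to do. Otherwise let T be the kernel of
    the retraction of G onto F; it commutes with N, as t does and N is normal.
    Start from an embedding f of G into A(Gamma) and delete vertices of Gamma
    (sending them to 1), keeping the map injective on T, until N is killed.
    To see that this is possible, suppose that n in N has image m <> 1. Some
    vertex v is such that m is not conjugate to its image under the deletion of
    v, since otherwise deleting all vertices one by one would show that m is
    conjugate to 1 (raag_conj_restrictions_trivial). Then m is not conjugate into
    A(Gamma - v), and such an element has an abelian centralizer within the
    kernel of the deletion of v (raag_centralizer_abelian). The image of T
    commutes with m, so the part of T killed by deleting v is an abelian normal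
    subgroup of G. But a ping-pong argument shows that T contains no nontrivial
    abelian normal subgroup of G (hnn_abelian_normal). So v can be deleted.

    At the end the map kills N and is injective on T. If it kills x in F, then it
    kills the commutator of x and t, which lies in T; so x commutes with t, and
    therefore x is in N. Hence F/N embeds into A(Gamma).

    The centralizer statement (hnn_centralizer_abelian) is proved on the boundary.
    After conjugation n is cyclically reduced, and its powers contract all finite
    streams to one infinite stream omega. Everything that commutes with n fixes
    omega. An element x fixing omega and retracting to 1 shifts the ray to omega,
    x p_(j+k) = p_(i+k) for all k, where the p_k are the initial segments of
    omega, taken in E. Two shifts of the same ray commute. *)

Set Implicit Arguments.
Unset Strict Implicit.
Unset Printing Implicit Defensive.

Local Open Scope classical_set_scope.
Local Open Scope group_scope.
Local Open Scope quotient_scope.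

(** * Homomorphisms out of presented groups *)

Section GroupMorphism.
Context (G B : groupType) (f : {multiplicative G -> B}).

Lemma morph1 : f 1 = 1.
Proof. by apply: (mulgI (f 1)); rewrite -gmulfM !mulg1. Qed.

Lemma morphV : {morph f : x / x^-1}.
Proof. by move=> x; apply: (mulgI (f x)); rewrite -gmulfM !mulgV morph1. Qed.

Lemma morphF : {morph f : x y / x / y}.
Proof. by move=> x y; rewrite gmulfM morphV. Qed.

Lemma morphJ : {morph f : x y / x ^ y}.
Proof. by move=> x y; rewrite /conjg !gmulfM morphV. Qed.

Lemma morphR : {morph f : x y / [~ x, y]}.
Proof. by move=> x y; rewrite /commg gmulfM morphJ morphV. Qed.

Lemma morph_inj : (forall x, f x = 1 -> x = 1) -> injective f.
Proof. by move=> fI x y xy; apply/divg1_eq/fI; rewrite morphF xy mulgV. Qed.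

End GroupMorphism.

(** Homomorphisms are produced as existence statements, since most of them are
    known only up to the values they take on generators. *)
Lemma morphism_pack (G B : groupType) (f : G -> B) :
  {morph f : x y / x * y} -> exists g : {multiplicative G -> B}, g =1 f.
Proof.
move=> fM.
pose g : {multiplicative G -> B} := HB.pack f (isMultiplicative.Build G B f fM).
by exists g.
Qed.

Lemma subgroup_mul (G : groupType) (K : set G) x y :
  is_subgroup K -> K x -> K y -> K (x * y).
Proof.
move=> [K1 KF] Kx Ky; rewrite -[y]invgK; apply: (KF) => //.
by rewrite -[y^-1]mul1g; exact: KF.
Qed.

Lemma subgroup_inv (G : groupType) (K : set G) x :
  is_subgroup K -> K x -> K x^-1.
Proof. by move=> [K1 KF] Kx; rewrite -[x^-1]mul1g; exact: KF. Qed.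

Lemma word_class_cat (X : choiceType) (u v : seq (X * bool)) :
  word_class (u ++ v) = word_class u * word_class v.
Proof. by rewrite -free_mulE. Qed.

Lemma word_class1 (X : choiceType) (x : X) b :
  word_class [:: (x, b)] = if b then free_gen x else (free_gen x)^-1.
Proof. by case: b => //; exact: esym (free_invE [:: (x, true)]). Qed.

Lemma free_group_gen (X : choiceType) (K : set (free_group X)) :
  is_subgroup K -> (forall x, K (free_gen x)) -> forall w, K w.
Proof.
move=> sK Kgen w; rewrite -(word_class_repr w).
elim: (repr w) => [|[x b] u IH]; first by case: sK.
rewrite -cat1s word_class_cat; apply: (subgroup_mul sK) => //.
rewrite word_class1; case: b => //; exact: (subgroup_inv sK).
Qed.

Lemma presented_generated (X : choiceType) (R : set (free_group X))
    (K : set (presented R)) :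
  is_subgroup K -> (forall x, K (presented_gen R x)) -> forall w, K w.
Proof.
move=> [K1 KF] Kgen w; rewrite -(coset_repr w).
apply: (@free_group_gen _ [set u | K (coset _ u)]) => //.
by split=> //= x y Kx Ky; rewrite morphF; exact: KF.
Qed.

Lemma free_group_lift (X : choiceType) (B : groupType) (phi : X -> B) :
  exists f : {multiplicative free_group X -> B},
    forall x, f (free_gen x) = phi x.
Proof.
pose ev (w : seq (X * bool)) : B :=
  \big[*%g/1]_(a <- w) (if a.2 then phi a.1 else (phi a.1)^-1).
have evcat u v : ev (u ++ v) = ev u * ev v by rewrite /ev big_cat.
have evE u v : word_equiv u v -> ev u = ev v.
  elim=> {u v} [//|u v _ -> //|u v w _ -> _ -> //|u x b v].
  rewrite !evcat /ev !big_cons /=; congr (_ * _).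
  by case: b; rewrite /= ?mulVKg ?mulKg.
have [|f fE] := @morphism_pack (free_group X) B (fun w => ev (repr w)).
  by move=> x y; rewrite -evcat; exact/evE/repr_word_class.
exists f => x; rewrite fE (evE _ _ (repr_word_class _)).
by rewrite /ev big_seq1.
Qed.

Lemma quotient_lift (G B : groupType) (N : normal_subgroup G)
    (f : {multiplicative G -> B}) :
  (forall x, normal_set N x -> f x = 1) ->
  exists g : {multiplicative quotient_group N -> B},
    forall x, g (coset N x) = f x.
Proof.
move=> fN.
have fE x y : coset N x = coset N y -> f x = f y.
  by move=> /coset_eq/fN; rewrite gmulfM morphV => /mulg1_eq; rewrite invgK.
have [|g gE] := @morphism_pack (quotient_group N) B (fun w => f (repr w)).
  move=> x y; rewrite -gmulfM; apply: fE.
  apply: etrans (coset_repr _) _; rewrite gmulfM.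
  by congr (_ * _); exact/esym/coset_repr.
by exists g => x; rewrite gE; apply: fE; rewrite coset_repr.
Qed.

Lemma normal_closure_kernel (G B : groupType) (R : set G)
    (f : {multiplicative G -> B}) :
  (forall r, R r -> f r = 1) ->
  forall x, normal_set (normal_closure R) x -> f x = 1.
Proof.
move=> fR x Hx; apply: (Hx [set y | f y = 1]); split=> //; split.
  by split=> [|y z /= fy fz]; rewrite /= ?morph1 // morphF fy fz mulgV.
by move=> y g /= fy; rewrite morphJ fy conj1g.
Qed.

Lemma normal_closure_sub (G : groupType) (R : set G) x :
  R x -> normal_set (normal_closure R) x.
Proof. by move=> Rx K [_]; exact. Qed.

Lemma coset1P (G : groupType) (N : normal_subgroup G) x :
  coset N x = 1 <-> normal_set N x.
Proof.
rewrite -[1]/(coset N 1); split=> [/esym|H].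
  by move/coset_eq; rewrite invg1 mul1g.
by apply/esym/coset_eq; rewrite invg1 mul1g.
Qed.

(** The universal property of a presentation. The relators are tested against
    any homomorphism extending phi, so that no particular extension to the free
    group has to be named. *)
Lemma presented_lift (X : choiceType) (R : set (free_group X))
    (B : groupType) (phi : X -> B) :
  (forall f : {multiplicative free_group X -> B},
     (forall x, f (free_gen x) = phi x) -> forall r, R r -> f r = 1) ->
  exists g : {multiplicative presented R -> B},
    forall x, g (presented_gen R x) = phi x.
Proof.
move=> phiR; have [f fE] := free_group_lift phi.
have [g gE] := quotient_lift (normal_closure_kernel (phiR f fE)).
by exists g => x; rewrite gE fE.
Qed.

(** * The group of bijections of a type *)
Record bijection (T : Type) := Bijection {
  bij_fun : T -> T;
  bij_inv : T -> T;
  bij_funK : cancel bij_fun bij_inv;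
  bij_invK : cancel bij_inv bij_fun
}.

Section BijectionGroup.
Context (T : Type).
Implicit Types f g : bijection T.

Lemma bijection_eq f g : bij_fun f =1 bij_fun g -> f = g.
Proof.
case: f g => [f f' fK f'K] [g g' gK g'K] /= /funext fg; subst g.
have fg' : f' = g' by apply/funext => x; rewrite -{1}[x]g'K fK.
by subst g'; congr Bijection; exact: Prop_irrelevance.
Qed.

HB.instance Definition _ := gen_eqMixin (bijection T).
HB.instance Definition _ := gen_choiceMixin (bijection T).

Definition bij_one : bijection T := @Bijection T id id (fun=> erefl) (fun=> erefl).

Definition bij_opp f : bijection T := Bijection (@bij_invK _ f) (@bij_funK _ f).

Definition bij_mul f g : bijection T :=
  Bijection (can_comp (@bij_funK _ f) (@bij_funK _ g))
            (can_comp (@bij_invK _ g) (@bij_invK _ f)).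

Lemma bij_mulA : associative bij_mul.
Proof. by move=> f g h; exact: bijection_eq. Qed.

Lemma bij_mul1 : left_id bij_one bij_mul.
Proof. by move=> f; exact: bijection_eq. Qed.

Lemma bij_mulr1 : right_id bij_one bij_mul.
Proof. by move=> f; exact: bijection_eq. Qed.

Lemma bij_mulV : left_inverse bij_one bij_opp bij_mul.
Proof. by move=> f; apply: bijection_eq => x /=; rewrite bij_funK. Qed.

Lemma bij_mulrV : right_inverse bij_one bij_opp bij_mul.
Proof. by move=> f; apply: bijection_eq => x /=; rewrite bij_invK. Qed.

HB.instance Definition _ := isGroup.Build (bijection T)
  bij_mulA bij_mul1 bij_mulr1 bij_mulV bij_mulrV.

End BijectionGroup.

(** * HNN extensions and reduced streams *)

(** The universal property of the extension of H by a letter v that centralizes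
    C, together with generation. With B = H it also provides the retraction of E
    onto H that sends v to 1. *)
Record is_hnn (H E : groupType) (C : set H) (iota : {multiplicative H -> E})
    (v : E) : Prop := IsHNN {
  hnn_commute : forall c, C c -> commute v (iota c);
  hnn_generated : forall K : set E, is_subgroup K ->
    (forall h, K (iota h)) -> K v -> forall x, K x;
  hnn_lift : forall (B : groupType) (f : {multiplicative H -> B}) (b : B),
    (forall c, C c -> commute b (f c)) ->
    exists g : {multiplicative E -> B}, (forall h, g (iota h) = f h) /\ g v = b
}.

Section Streams.
Context (H : groupType).
Implicit Types (h : H).

(** A letter is a coset of C with a sign, or the end marker None. Any subset of H
    is admitted as a coset, since only its left translates matter; this avoids
    a quotient type and keeps letters independent of C. *)
Definition letter : Type := option (set H * bool).

Definition translate h (l : letter) : letter :=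
  if l is Some (X, b) then Some ([set y | X (h^-1 * y)], b) else None.

Lemma translate1 l : translate 1 l = l.
Proof.
case: l => [[X b]|] //=; congr (Some (_, _)).
by apply/funext => y /=; rewrite invg1 mul1g.
Qed.

Lemma translateM h k l : translate (h * k) l = translate h (translate k l).
Proof.
case: l => [[X b]|] //=; congr (Some (_, _)).
by apply/funext => y /=; rewrite invgM mulgA.
Qed.

Lemma translateK h : cancel (translate h) (translate h^-1).
Proof. by move=> l; rewrite -translateM mulVg translate1. Qed.

Lemma translateVK h : cancel (translate h^-1) (translate h).
Proof. by move=> l; rewrite -translateM mulgV translate1. Qed.

Definition opposite (l : letter) : letter :=
  if l is Some (X, b) then Some (X, ~~ b) else None.

Lemma translate_opposite h l :
  translate h (opposite l) = opposite (translate h l).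
Proof. by case: l => [[X b]|]. Qed.

(** Nothing is required after an end marker. Hence finite words, infinite words
    and streams that resume after an end marker are treated alike. *)
Definition reduced (u : nat -> letter) : Prop :=
  forall i, u i <> None -> u i.+1 <> opposite (u i).

Record stream := Stream {
  stream_fun :> nat -> letter;
  streamP : reduced stream_fun
}.

Lemma stream_eq (u u' : stream) : u =1 u' -> u = u'.
Proof.
case: u u' => [u uP] [u' u'P] /= /funext uu'; subst u'; congr Stream.
exact: Prop_irrelevance.
Qed.

Lemma translate_reduced h (u : stream) : reduced (translate h \o u).
Proof.
move=> i /= ui; rewrite -translate_opposite => /(can_inj (translateK h)).
by apply: streamP => ui0; rewrite ui0 in ui.
Qed.

Definition stream_translate h (u : stream) : stream :=
  Stream (@translate_reduced h u).

Definition push (l : letter) (u : nat -> letter) : nat -> letter :=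
  if u 0 == opposite l then fun i => u i.+1
  else fun i => if i is j.+1 then u j else l.

Lemma push_reduced l (u : stream) : reduced (push l u).
Proof.
rewrite /push; case: eqP => ul [|i] /=; try exact: streamP.
by move=> _; exact: ul.
Qed.

Definition stream_push l (u : stream) : stream := Stream (@push_reduced l u).

Lemma stream_pushK l (u : stream) : l <> None ->
  stream_push (opposite l) (stream_push l u) = u.
Proof.
move=> l0; have ll : opposite (opposite l) = l.
  by case: l l0 => [[X b]|] //=; rewrite negbK.
have ol0 : opposite l <> None by case: l l0 {ll} => [[X b]|].
apply: stream_eq => i; rewrite /= {2}/push.
case: eqP => ul; rewrite /push ll ?eqxx //.
case: eqP => [u1|_]; last by case: i.
by case: (@streamP u 0); rewrite ul ?ll.
Qed.

Definition void_stream : stream.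
Proof. by exists (fun=> None). Defined.

End Streams.

(** * The action of an HNN extension on streams *)
Section HNN.
Context (H E : groupType) (C : set H) (iota : {multiplicative H -> E}) (v : E).
Context (sC : is_subgroup C) (hE : is_hnn C iota v).

Lemma hnn_retract_exists :
  exists rho : {multiplicative E -> H}, (forall h, rho (iota h) = h) /\ rho v = 1.
Proof.
have [f fE] := @morphism_pack H H id (fun _ _ => erefl).
have [|rho [rhoi rhov]] := hnn_lift hE (f := f) (b := 1).
  by move=> c _; rewrite /commute mul1g mulg1.
by exists rho; split=> // h; rewrite rhoi fE.
Qed.

Definition hnn_retract : {multiplicative E -> H} := sval (cid hnn_retract_exists).
Local Notation rho := hnn_retract.

Lemma hnn_retract_base h : rho (iota h) = h.
Proof. by rewrite /rho; case: cid => ? []. Qed.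

Lemma hnn_retract_stable : rho v = 1.
Proof. by rewrite /rho; case: cid => ? []. Qed.

Definition stable (b : bool) : E := if b then v else v^-1.

Lemma stableV b : (stable b)^-1 = stable (~~ b).
Proof. by case: b; rewrite /= ?invgK. Qed.

Lemma hnn_retract_stable_pow b : rho (stable b) = 1.
Proof. by case: b; rewrite /= ?morphV hnn_retract_stable ?invg1. Qed.

Lemma stable_commute b c : C c -> commute (stable b) (iota c).
Proof.
move=> Cc; have vc := hnn_commute hE Cc.
by case: b => //; exact/commute_sym/commuteV/commute_sym.
Qed.

Lemma hnn_ind (P : E -> Prop) :
  P 1 -> (forall h x, P x -> P (iota h * x)) ->
  (forall b x, P x -> P (stable b * x)) -> forall x, P x.
Proof.
move=> P1 Ph Pv x; rewrite -[x]mulg1; move: 1 P1.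
(* Closing under inverses is built into K, since P gives no information on them. *)
pose K : set E := [set x | (forall y, P y -> P (x * y)) /\
                           (forall y, P y -> P (x^-1 * y))].
suff: K x by case.
apply: (hnn_generated hE).
- split=> [|{}x y [Px Px'] [Py Py']].
    by split=> y; rewrite ?invg1 mul1g.
  split=> z Pz; first by rewrite -mulgA; exact/Px/Py'.
  by rewrite invgM invgK -mulgA; exact/Py/Px'.
- by move=> h; split=> y; rewrite -?morphV; exact: Ph.
- by split=> y; [exact: (Pv true)|exact: (Pv false)].
Qed.

(** The coset C itself: the letter that v and its inverse prepend. *)
Definition base (b : bool) : letter H := Some (C, b).

Lemma translate_base h b b' :
  translate h (base b) = base b' <-> C h /\ b = b'.
Proof.
split=> [[hC ->]|[Ch <-]].
  split=> //; have: C 1 by case: sC.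
  by rewrite -{1}[1](mulVg h) => H1; rewrite -hC.
congr (Some (_, _)); apply/funext => y /=; apply/propext; split=> Cy.
  by rewrite -[y](mulVKg h); exact: subgroup_mul.
by apply: subgroup_mul => //; exact: subgroup_inv.
Qed.

(** Prepending with cancellation is invertible on reduced streams, and it commutes
    with the translations by C because these fix the coset C. So the universal
    property provides the action. *)
Lemma hnn_action_exists : exists g : {multiplicative E -> bijection (stream H)},
  (forall h, bij_fun (g (iota h)) =1 stream_translate h) /\
  (forall b, bij_fun (g (stable b)) =1 stream_push (base b)).
Proof.
have pushK b : cancel (stream_push (base b)) (stream_push (base (~~ b))).
  by move=> u; exact: stream_pushK.
have pushK' : cancel (stream_push (base false)) (stream_push (base true)).
  exact: pushK false.
have transK (h : H) : cancel (stream_translate h) (stream_translate h^-1).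
  by move=> u; apply: stream_eq => i /=; rewrite translateK.
have transVK (h : H) : cancel (stream_translate h^-1) (stream_translate h).
  by move=> u; apply: stream_eq => i /=; rewrite translateVK.
have [|f fE] := @morphism_pack H (bijection (stream H))
    (fun h => Bijection (transK h) (transVK h)).
  move=> h k; apply: bijection_eq => u; apply: stream_eq => i /=.
  by rewrite translateM.
have [|g [gi gv]] := hnn_lift hE (f := f) (b := Bijection (pushK true) pushK').
  move=> c Cc; rewrite /commute fE; apply: bijection_eq => u.
  apply: stream_eq => i /=; rewrite /push -/(base false).
  have cb b : translate c (base b) = base b by apply/translate_base.
  have -> : (translate c (u 0) == base false) = (u 0 == base false).
    by rewrite -{1}(cb false) (can_eq (translateK c)).
  by case: eqP => // _; case: i => [|i] //; exact: cb.
exists g; split=> [h u|b u]; first by rewrite gi fE.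
case: b => /=; first by rewrite gv.
by rewrite morphV gv.
Qed.

Definition act (x : E) : stream H -> stream H :=
  bij_fun (sval (cid hnn_action_exists) x).

Lemma act1 u : act 1 u = u.
Proof. by rewrite /act morph1. Qed.

Lemma actM x y u : act (x * y) u = act x (act y u).
Proof. by rewrite /act gmulfM. Qed.

Lemma act_base h (u : stream H) i : act (iota h) u i = translate h (u i).
Proof. by rewrite /act; case: cid => g [/= -> _]. Qed.

Lemma act_stable b (u : stream H) i : act (stable b) u i = push (base b) u i.
Proof. by rewrite /act; case: cid => g [/= _ ->]. Qed.

Lemma act_push b (u : stream H) : u 0 <> base (~~ b) ->
  act (stable b) u 0 = base b /\ forall i, act (stable b) u i.+1 = u i.
Proof. by move=> /eqP/negbTE ub; split=> *; rewrite act_stable /push ub. Qed.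

Lemma act_cancel b (u : stream H) i :
  u 0 = base (~~ b) -> act (stable b) u i = u i.+1.
Proof. by move=> ub; rewrite act_stable /push ub eqxx. Qed.

(** * Words in the base and the stable letter *)
Definition syllable : Type := (bool * H)%type.

Definition word_val (w : seq syllable) : E :=
  foldr (fun s x => stable s.1 * iota s.2 * x) 1 w.

Lemma word_val_cat w1 w2 : word_val (w1 ++ w2) = word_val w1 * word_val w2.
Proof. by elim: w1 => [|s w1 IH] /=; rewrite ?mul1g // IH mulgA. Qed.

Lemma hnn_word x : exists g w, x = iota g * word_val w.
Proof.
elim/hnn_ind: x => [|h x [g [w ->]]|b x [g [w ->]]].
- by exists 1, [::]; rewrite morph1 mulg1.
- by exists (h * g), w; rewrite gmulfM mulgA.
- by exists 1, ((b, g) :: w); rewrite morph1 mul1g /= mulgA.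
Qed.

(** A factor from the base on the right of a word is merged into the base factor
    before it, without changing the number of stable letters. *)
Lemma word_absorb g w k : exists g' w',
  size w' = size w /\ iota g * word_val w * iota k = iota g' * word_val w'.
Proof.
elim: w g => [|s w IH] g; first by exists (g * k), [::]; rewrite /= !mulg1 gmulfM.
have [g' [w' [sz e]]] := IH s.2.
exists g, ((s.1, g') :: w'); split; first by rewrite /= sz.
by rewrite /= -[in RHS]mulgA -e !mulgA.
Qed.

Lemma word_absorb_cons s w k : exists s' w',
  size w' = size w /\ word_val (s :: w) * iota k = word_val (s' :: w').
Proof.
have [g' [w' [sz e]]] := word_absorb s.2 w k.
by exists (s.1, g'), w'; split=> //=; rewrite -[RHS]mulgA -e !mulgA.
Qed.

(** Two consecutive syllables are incompatible when the stable letters on both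
    sides of an element of C cancel. *)
Definition compatible : rel syllable :=
  fun s s' => ~~ `[< C s.2 /\ s'.1 = ~~ s.1 >].

Lemma compatibleP s s' :
  reflect (translate s.2 (base s'.1) <> base (~~ s.1)) (compatible s s').
Proof.
apply: (iffP negP) => ss' e; apply: ss'.
  exact/asboolP/translate_base.
by move/asboolP/translate_base: e.
Qed.

Lemma word_cancel s s' w : ~~ compatible s s' ->
  word_val (s :: s' :: w) = iota (s.2 * s'.2) * word_val w.
Proof.
move=> /negPn/asboolP[Cs s1]; rewrite /= s1 gmulfM !mulgA; congr (_ * _ * _).
by rewrite (stable_commute _ Cs) -stableV mulgK.
Qed.

Lemma not_sorted_split w : ~~ sorted compatible w ->
  exists a s s' c, w = a ++ s :: s' :: c /\ ~~ compatible s s'.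
Proof.
elim: w => [|s [|s' w] IH] //=; rewrite negb_and => /orP[ss'|sw].
  by exists [::], s, s', w.
by have [a [t [t' [c [-> tt']]]]] := IH sw; exists (s :: a), t, t', c.
Qed.

Lemma hnn_reduced_word x :
  exists g w, x = iota g * word_val w /\ sorted compatible w.
Proof.
have [g [w ->]] := hnn_word x.
have [m wm] := ubnP (size w); elim: m => // m IH in g w wm *.
case: (boolP (sorted compatible w)) => [sw|]; first by exists g, w.
move=> /not_sorted_split[a [s [s' [c [wE ss']]]]].
have [g' [a' [sz e]]] := word_absorb g a (s.2 * s'.2).
have [|g2 [w2 [e2 sw2]]] := IH g' (a' ++ c).
  by move: wm; rewrite wE !size_cat sz /= !addnS; lia.
exists g2, w2; split=> //; rewrite -e2 wE !word_val_cat word_cancel //.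
by rewrite mulgA mulgA e !mulgA.
Qed.

Lemma act_word_cons s w u :
  act (word_val (s :: w)) u = act (stable s.1) (act (iota s.2) (act (word_val w) u)).
Proof. by rewrite /= !actM. Qed.

(** If the last syllable does not cancel the first letter of u, then no later
    syllable cancels anything: each finds the letter just prepended, and
    compatibility says that this letter is not cancelled. *)
Lemma act_word_head s w (u : stream H) :
  sorted compatible (s :: w) ->
  translate (last s w).2 (u 0) <> base (~~ (last s w).1) ->
  act (word_val (s :: w)) u 0 = base s.1.
Proof.
elim: w s => [|s' w IH] s; rewrite act_word_cons.
  by rewrite /= act1 => _ us; apply: (act_push _).1; rewrite act_base.
move=> /andP[/compatibleP ss' sw] us.
by apply: (act_push _).1; rewrite act_base (IH s').
Qed.

(** Without cancellation a word prepends as many letters as it has syllables,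
    and these letters do not depend on the stream. So it shifts the first
    disagreement of two streams to the right by its length. *)
Lemma act_word_contract s w (u u' : stream H) i :
  sorted compatible (s :: w) ->
  translate (last s w).2 (u 0) <> base (~~ (last s w).1) ->
  translate (last s w).2 (u' 0) <> base (~~ (last s w).1) ->
  (forall k, k < i -> u k = u' k) ->
  forall k, k < (size w).+1 + i ->
    act (word_val (s :: w)) u k = act (word_val (s :: w)) u' k.
Proof.
move=> sw us us' uu'.
elim: w s sw us us' => [|s' w IH] s sw us us' k; rewrite !(act_word_cons s).
  move: us us'; rewrite /= !act1 => us us'.
  have [u0 uS] := @act_push s.1 (act (iota s.2) u) ltac:(by rewrite act_base).
  have [u'0 u'S] := @act_push s.1 (act (iota s.2) u') ltac:(by rewrite act_base).
  by case: k => [|k] ki; rewrite ?u0 ?u'0 // uS u'S !act_base uu'.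
have /andP[/compatibleP ss' sw'] := sw.
set x := act (word_val _) u; set x' := act (word_val _) u'.
have x0 : x 0 = base s'.1 by exact: act_word_head.
have x'0 : x' 0 = base s'.1 by exact: act_word_head.
have [u0 uS] := @act_push s.1 (act (iota s.2) x) ltac:(by rewrite act_base x0).
have [u'0 u'S] := @act_push s.1 (act (iota s.2) x') ltac:(by rewrite act_base x'0).
case: k => [|k] ki; rewrite ?u0 ?u'0 // uS u'S !act_base.
by congr translate; exact: IH.
Qed.

(** A word that does not end by prepending has cancelled one letter for each of
    its syllables, so that an end marker has moved to the left by its length.
    Since this cannot go on forever, a power of a cyclically reduced word
    prepends its first letter. *)
Lemma act_word_escape w (u : stream H) j : sorted compatible w -> u j = None ->
  (exists s w', w = s :: w' /\ act (word_val w) u 0 = base s.1) \/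
  (exists2 j', j' + size w = j & act (word_val w) u j' = None).
Proof.
move=> sw uj; elim: w sw => [|s w IH] sw.
  by right; exists j; rewrite ?addn0 //= act1.
rewrite act_word_cons; set x := act (word_val w) u.
have [eq0|/eqP neq0] := eqVneq (act (iota s.2) x 0) (base (~~ s.1)); last first.
  by left; exists s, w; split=> //; apply: (act_push _).1.
have [[s' [w' [wE x0]]]|[j' jj' xj']] := IH (path_sorted sw).
  left; exists s, w; split=> //; apply: (act_push _).1.
  by move: sw; rewrite wE /= => /andP[/compatibleP + _]; rewrite act_base -/x x0.
right; case: j' => [|j'] in jj' xj' *.
  by move: eq0; rewrite act_base -/x xj'.
exists j'; first by rewrite /= addnS -addSn.
by rewrite act_cancel // act_base -/x xj'.
Qed.

(** Britton's lemma: the word, applied to the empty stream, leaves a visible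
    first letter. *)
Lemma hnn_normal_form g w :
  sorted compatible w -> iota g * word_val w = 1 -> w = [::] /\ g = 1.
Proof.
case: w => [|s w] sw.
  by rewrite mulg1 => /(congr1 rho); rewrite hnn_retract_base morph1.
move=> /(congr1 (fun x => act x (void_stream H) 0)).
by rewrite actM act_base act1 act_word_head.
Qed.

(** * Rays and the boundary *)

(** The conjugate of the stable letter by a representative of the coset. These
    conjugates generate the kernel of the retraction onto the base freely, and
    a stream is a path in the corresponding Cayley graph. *)
Definition edge_elt (l : letter H) : E :=
  if l is Some (X, b) then
    if pselect (exists h, translate h (base b) = l) is left ex
    then iota (sval (cid ex)) * stable b * (iota (sval (cid ex)))^-1 else 1
  else 1.

Lemma edge_eltE g b :
  edge_elt (translate g (base b)) = iota g * stable b * (iota g)^-1.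
Proof.
rewrite {1}/translate /edge_elt /=; case: pselect => [ex|]; last first.
  by case; exists g.
case: cid => h /= hg.
have {hg} : translate (g^-1 * h) (base b) = base b.
  by rewrite translateM; apply: (canLR (translateK g)); exact: hg.
move=> /translate_base[/(stable_commute b) + _].
rewrite gmulfM morphV /commute => e.
apply: (mulgI (iota g)^-1); apply: (mulIg (iota h)).
by rewrite !mulgA mulgVK mulVg mul1g -[RHS]mulgA e.
Qed.

Lemma edge_elt_base b : edge_elt (base b) = stable b.
Proof. by rewrite -[base b]translate1 edge_eltE morph1 mul1g invg1 mulg1. Qed.

Lemma edge_elt_translate h l :
  edge_elt (translate h l) * iota h = iota h * edge_elt l.
Proof.
have [[g [b ->]]|nex] := pselect (exists g b, l = translate g (base b)).
  by rewrite -translateM !edge_eltE gmulfM invgM !mulgA mulgVK.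
have coset0 l' : (forall g b, l' <> translate g (base b)) -> edge_elt l' = 1.
  case: l' => [[X b]|] //= nl; case: pselect => // -[g ge].
  by case: (nl g b); rewrite ge.
rewrite !coset0 ?mul1g ?mulg1 // => g b e; apply: nex.
  by exists g, b.
by exists (h^-1 * g), b; rewrite translateM -e translateK.
Qed.

(** The vertices p_0, p_1, ... of the path spelled by the letters of u. *)
Fixpoint ray (u : nat -> letter H) (i : nat) : E :=
  if i is j.+1 then ray u j * edge_elt (u j) else 1.

Lemma eq_ray u u' : u =1 u' -> ray u =1 ray u'.
Proof. by move=> uu'; elim=> //= i ->; rewrite uu'. Qed.

Lemma ray_shift u i : ray u i.+1 = edge_elt (u 0) * ray (fun k => u k.+1) i.
Proof.
elim: i => [|i IH]; first by rewrite /= mul1g mulg1.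
by rewrite -[LHS]/(ray u i.+1 * edge_elt (u i.+1)) IH /= mulgA.
Qed.

Lemma ray_translate h u i :
  ray (translate h \o u) i * iota h = iota h * ray u i.
Proof.
elim: i => [|i IH] /=; first by rewrite mul1g mulg1.
by rewrite -mulgA edge_elt_translate mulgA IH mulgA.
Qed.

(** The action moves paths as left multiplication does, up to finitely many
    letters at the beginning: once those have been dropped on both sides, x
    carries the vertices of u to those of x u, and only translates the letters.
    The base factor on the right appears because vertices are recorded by
    elements of the kernel. *)
Lemma act_ray x (u : stream H) : exists i j, forall k,
  x * ray u (j + k) = ray (act x u) (i + k) * iota (rho x) /\
  act x u (i + k) = translate (rho x) (u (j + k)).
Proof.
elim/hnn_ind: x => [|h x [i [j IH]]|b x [i [j IH]]].
- by exists 0, 0 => k; rewrite act1 !morph1 mul1g mulg1 translate1.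
- exists i, j => k; have [IH1 IH2] := IH k.
  rewrite actM act_base gmulfM hnn_retract_base translateM IH2; split=> //.
  rewrite -mulgA IH1 gmulfM !mulgA -ray_translate; congr (_ * _ * _).
  by apply: eq_ray => m; rewrite act_base.
- rewrite gmulfM hnn_retract_stable_pow mul1g.
  have [ub|/eqP ub] := eqVneq (act x u 0) (base (~~ b)); last first.
    have [u0 uS] := act_push ub.
    exists i.+1, j => k; have [IH1 IH2] := IH k.
    rewrite actM uS; split=> //; rewrite ray_shift u0 edge_elt_base.
    rewrite -!mulgA IH1 !mulgA; congr (_ * _ * _).
    by apply: eq_ray => m; rewrite uS.
  exists i, j.+1 => k; have := IH k.+1; rewrite addSnnS !addnS => -[IH1 IH2].
  rewrite actM act_cancel //; split=> //.
  rewrite -!mulgA IH1 ray_shift ub edge_elt_base -stableV !mulgA mulgV mul1g.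
  by congr (_ * _); apply: eq_ray => m; rewrite act_cancel.
Qed.

(** The first letters of x u depend on finitely many letters of u, uniformly
    in u. *)
Lemma act_continuous x i : exists j, forall u u' : stream H,
  (forall k, k < j -> u k = u' k) -> forall k, k < i -> act x u k = act x u' k.
Proof.
elim/hnn_ind: x i => [|h x IH|b x IH] i.
- by exists i => u u' uu' k ki; rewrite !act1 uu'.
- have [j jP] := IH i; exists j => u u' uu' k ki.
  by rewrite !actM !act_base (jP u u').
- have [j jP] := IH i.+1; exists j => u u' /jP uu' k ki.
  rewrite !actM !act_stable /push uu' //; case: eqP => _; first exact: uu'.
  by case: k ki => // k ki; apply: uu'; exact: ltnW (ltnW ki).
Qed.

(** * Centralizers of elements not conjugate into the base *)
Lemma word_val_rot a b : word_val (a ++ b) ^ word_val a = word_val (b ++ a).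
Proof. by rewrite !word_val_cat /conjg !mulgA mulVg mul1g. Qed.

(** Among the words representing conjugates of n, one with the fewest stable
    letters is cyclically reduced: an incompatible pair could be rotated to the
    front and cancelled, and the base factor thus freed can be merged into the
    rest of the word after a conjugation. The word does not vanish, since n is
    not conjugate into the base. *)
Lemma hnn_cyclically_reduced n : (forall y h, n ^ y <> iota h) ->
  exists s w y, n ^ y = word_val (s :: w) /\ cycle compatible (s :: w).
Proof.
move=> nH.
have [s0 [w0 [y0 e0]]] : exists s w y, n ^ y = word_val (s :: w).
  have [g [[|s w] nE]] := hnn_word n.
    by case: (nH 1 g); rewrite nE mulg1 conjg1.
  have [s' [w' [_ e]]] := word_absorb_cons s w g.
  by exists s', w', (iota g); rewrite -e nE /conjg -mulgA mulKg.
have [m] := ubnP (size w0); elim: m => // m IH in s0 w0 y0 e0 *; rewrite ltnS => wm.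
have [cyc|] := boolP (cycle compatible (s0 :: w0)); first by exists s0, w0, y0.
rewrite /= rcons_path negb_and => bad.
have {bad} [y [s1 [s2 [c [e ss [sz]]]]]] : exists y s1 s2 c,
    [/\ word_val (s0 :: w0) ^ y = word_val (s1 :: s2 :: c),
        ~~ compatible s1 s2 & size (s0 :: w0) = (size c).+2].
  case/orP: bad => [bad|].
    have [a [s1 [s2 [c [-> ss]]]]] := @not_sorted_split (s0 :: w0) bad.
    exists (word_val a), s1, s2, (c ++ a); split=> //.
      by rewrite word_val_rot.
    by rewrite !size_cat /= !addnS addnC.
  case/lastP: w0 {wm e0} => [|c l].
    by move=> /negPn/asboolP[_]; case: (s0.1).
  rewrite last_rcons => ss; exists (word_val (s0 :: c)), l, s0, c; split=> //.
    by rewrite -cats1 -cat_cons word_val_rot.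
  by rewrite /= size_rcons.
have {}e : n ^ (y0 * y) = iota (s1.2 * s2.2) * word_val c.
  by rewrite conjgM e0 e word_cancel.
case: c => [|s3 c] in e ss sz.
  by case: (nH (y0 * y) (s1.2 * s2.2)); rewrite e mulg1.
have [s4 [w4 [sz4 e4]]] := word_absorb_cons s3 c (s1.2 * s2.2).
apply: (IH s4 w4 (y0 * y * iota (s1.2 * s2.2))).
  by rewrite conjgM e -e4 /conjg -mulgA mulKg.
by rewrite sz4 (leq_trans _ wm) // sz /=.
Qed.

(** Geometrically: n has an axis in the tree, its centralizer preserves the
    attracting end of this axis, and the kernel of the retraction acts freely on
    the vertices, so that the elements of the kernel fixing an end are determined
    by the distance they translate along it. *)
Lemma hnn_centralizer_abelian n x y : (forall z h, n ^ z <> iota h) ->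
  commute x n -> commute y n -> rho x = 1 -> rho y = 1 -> commute x y.
Proof.
move=> nH xn yn rx ry.
have [s [w [z [nz cyc]]]] := hnn_cyclically_reduced nH.
suff: commute (x ^ z) (y ^ z).
  by rewrite /commute -!conjMg => /conjg_inj.
have {}xn : commute (x ^ z) (word_val (s :: w)).
  by rewrite -nz /commute -!conjMg xn.
have {}yn : commute (y ^ z) (word_val (s :: w)).
  by rewrite -nz /commute -!conjMg yn.
have {}rx : rho (x ^ z) = 1 by rewrite morphJ rx conj1g.
have {}ry : rho (y ^ z) = 1 by rewrite morphJ ry conj1g.
move: (x ^ z) (y ^ z) => {nH nz n z} {}x {}y in xn yn rx ry *.
set n := word_val (s :: w) in xn yn.
move: cyc; rewrite /= rcons_path => /andP[sw /compatibleP ls].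
have iterS k u : act (n ^+ k.+1) u = act n (act (n ^+ k) u).
  by rewrite expgS actM.
have iterS' k u : act (n ^+ k.+1) u = act (n ^+ k) (act n u).
  by rewrite expgSr actM.
have nhead (u : stream H) : u 0 = base s.1 -> act n u 0 = base s.1.
  by move=> u0; apply: act_word_head => //; rewrite u0.
have khead k (u : stream H) : u 0 = base s.1 -> act (n ^+ k) u 0 = base s.1.
  by move=> u0; elim: k => [|k IH]; rewrite ?act1 // iterS nhead.
have contract k (u u' : stream H) : u 0 = base s.1 -> u' 0 = base s.1 ->
    forall i, i < k -> act (n ^+ k) u i = act (n ^+ k) u' i.
  move=> u0 u'0; elim: k => // k IH i ik; rewrite !iterS.
  apply: (act_word_contract (i := k)) => //; rewrite ?khead //.
  by rewrite addSn (leq_trans ik) // ltnS leq_addl.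
have escape j (u : stream H) : u j = None -> exists k, act (n ^+ k) u 0 = base s.1.
  have [m] := ubnP j; elim: m => // m IH in j u * => jm uj.
  have [[s' [w' [[<- _] u0]]]|[j' jj' u'j']] := @act_word_escape (s :: w) u j sw uj.
    by exists 1%N; rewrite expg1.
  have [|k kP] := IH j' (act n u) _ u'j'.
    by move: jm; rewrite -jj' /=; lia.
  by exists k.+1; rewrite iterS'.
(* The orbit of the empty stream enters the basin where n contracts; its limit
   f does not depend on the starting point. *)
pose o := void_stream H.
have [a0 a0P] := escape 0 o erefl.
pose u0 := act (n ^+ a0) o.
pose f i := act (n ^+ i.+1) u0 i.
have flim (u : stream H) k i : u 0 = base s.1 -> i < k -> act (n ^+ k) u i = f i.
  move=> uh ik; rewrite -(subnKC ik) expgnDr actM.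
  by apply: contract => //; exact: khead.
have fred : reduced f.
  move=> i fi; rewrite -(@flim u0 i.+2) // -(@flim u0 i.+2 i) //.
  by apply: streamP; rewrite (@flim u0).
pose omega : stream H := Stream fred.
have fixed t : commute t n -> act t omega = omega.
  move=> tn; apply: stream_eq => i.
  have [j jP] := act_continuous t i.+1.
  have [p [q /(_ 0)[_ tp]]] := act_ray t o.
  have [a aP] := escape (p + 0) (act t o) tp.
  pose k := j + i.+1.
  (* For a large power K of n, t omega agrees near i with t n^K o = n^K t o,
     and n^K t o agrees with omega there. *)
  rewrite (jP omega (act (n ^+ (k + a + a0)) o)) //; last first.
    move=> l lj; rewrite expgnDr actM flim //.
    by rewrite /k; apply: leq_trans lj _; rewrite -!addnA leq_addr.
  rewrite -actM (commuteX _ tn) actM addnAC expgnDr actM flim //.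
  by rewrite /k -addnA -addnCA leq_addr.
have [i [j Px]] := act_ray x omega.
have [i' [j' Py]] := act_ray y omega.
have {}Px k : x * ray omega (j + k) = ray omega (i + k).
  by have [] := Px k; rewrite rx morph1 mulg1 fixed.
have {}Py k : y * ray omega (j' + k) = ray omega (i' + k).
  by have [] := Py k; rewrite ry morph1 mulg1 fixed.
(* Both products carry the vertex j + j' to the vertex i + i'. *)
apply: (mulIg (ray omega (j + j'))).
rewrite -!mulgA (Px j') [i + j']addnC (Py i) [j + j']addnC (Py j).
by rewrite [i' + j]addnC (Px i') addnC.
Qed.

(** * Ping-pong *)
Lemma hnn_commute_base h : commute (iota h) v -> C h.
Proof.
move=> hv; have vhead (u : stream H) : u 0 = None -> act v u 0 = base true.
  by move=> u0; apply: (@act_push true u _).1; rewrite u0.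
have: act (iota h * v) (void_stream H) 0 = act (v * iota h) (void_stream H) 0.
  by rewrite hv.
rewrite !actM act_base !vhead ?act_base //.
by move=> /translate_base[].
Qed.

(** Let U be the set of streams that begin with the coset C. An element h of the
    base outside C moves U off itself, as does its inverse. A nontrivial element
    of the kernel of the retraction has a conjugate z that moves the complement
    of U into U, and then so does the inverse of z. Playing ping-pong with the
    empty stream, which is not in U, shows that z and its conjugate by h do not
    commute. *)
Lemma hnn_abelian_normal h (D : set E) : ~ C h ->
  (forall x g, D x -> D (x ^ g)) -> (forall x y, D x -> D y -> commute x y) ->
  forall x, D x -> rho x = 1 -> x = 1.
Proof.
move=> nCh DJ Dab x Dx rx; have [//|/eqP x1] := eqVneq x 1; exfalso.
pose U (u : stream H) := exists b, u 0 = base b.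
have [z Dz zU] : exists2 z, D z & forall u, ~ U u -> U (act z u).
  have [g [[|s w] [xE sw]]] := hnn_reduced_word x.
    case: x1; move: rx; rewrite xE mulg1 hnn_retract_base => ->.
    by rewrite morph1.
  set k := (last s w).2 * g.
  have xg : x ^ iota g = word_val (s :: w) * iota g.
    by rewrite xE /conjg -mulgA mulKg.
  have head (u : stream H) : translate k (u 0) <> base (~~ (last s w).1) ->
      act (x ^ iota g) u 0 = base s.1.
    rewrite translateM -act_base => uk.
    by rewrite xg actM; exact: act_word_head.
  (* If the last base factor k is in C, then only streams in U can meet
     a cancellation. Otherwise a conjugation by v puts a stable letter last. *)
  have [Ck|nCk] := pselect (C k).
    exists (x ^ iota g); first exact: DJ.
    move=> u Uu; exists s.1; apply: head => uk; apply: Uu.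
    exists (~~ (last s w).1); apply: (can_inj (translateK k)).
    by rewrite uk; apply/esym/translate_base.
  exists (x ^ (iota g * stable (~~ s.1))); first exact: DJ.
  move=> u Uu; exists s.1; rewrite conjgM [_ ^ stable _]conjgE stableV negbK 2!actM.
  apply: (act_push _).1; rewrite head; first by case; case: (s.1).
  rewrite (act_push _).1; first by move=> /translate_base[].
  by move=> u0; apply: Uu; eexists; exact: u0.
have zVU u : ~ U u -> U (act z^-1 u).
  move=> Uu; apply: contrapT => /zU; by rewrite -actM mulgV act1.
have hU k u : ~ C k -> U u -> ~ U (act (iota k) u).
  by move=> nCk [b ub] [b']; rewrite act_base ub => /translate_base[].
have nChV : ~ C h^-1.
  by move=> /(subgroup_inv sC); rewrite invgK.
have hU1 := hU _ _ nCh; have hU2 := hU _ _ nChV.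
have := Dab _ _ Dz (DJ z (iota h^-1) Dz); rewrite /conjg morphV invgK => e.
have {e} : z * (iota h * (z * (iota h^-1 *
    (z^-1 * (iota h * (z^-1 * iota h^-1)))))) = 1.
  move: e; rewrite /commute morphV !mulgA => ->.
  by rewrite -!mulgA !(mulKg, mulVKg, mulgV).
move=> /(congr1 (fun t => act t (void_stream H))); rewrite act1 !actM => e.
suff: U (void_stream H) by case.
rewrite -e; apply/zU/hU1/zU/hU2/zVU/hU1/zVU.
by case=> b; rewrite act_base.
Qed.

End HNN.

Lemma eq_on_generators (X : choiceType) (R : set (free_group X)) (B : groupType)
    (f g : {multiplicative presented R -> B}) :
  (forall x, f (presented_gen R x) = g (presented_gen R x)) -> f =1 g.
Proof.
move=> fg; apply: (@presented_generated _ _ [set w | f w = g w]) => //.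
split=> [|x y /= fx fy] /=; first by rewrite !morph1.
by rewrite !morphF fx fy.
Qed.

Lemma cosetF (G : groupType) (N : normal_subgroup G) :
  {morph coset N : x y / x / y}.
Proof. by move=> x y; rewrite morphF. Qed.

(** * The special HNN extension of a group along a normal subgroup *)
Section IntegerPower.
Context (B : groupType) (b : B).

Definition int_power (z : infinite_cyclic) : B :=
  match (z : int) with Posz n => b ^+ n | Negz n => b ^- n.+1 end.

Lemma int_powerS (z : int) : int_power (z + 1)%R = int_power z * b.
Proof.
case: z => n.
  by rewrite -[(_ + _)%R]/(Posz (n + 1)) addn1 /= expgSr.
case: n => [|n]; first by rewrite /= expg1 mulVg.
have -> : (Negz n.+1 + 1)%R = Negz n by lia.
by rewrite /= [b ^+ n.+2]expgS invgM mulgVK.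
Qed.

Lemma int_powerM : {morph int_power : x y / x * y}.
Proof.
move=> x y; change (int_power ((x : int) + (y : int))%R = int_power x * int_power y).
elim/int_ind: (y : int) => [|n IH|n IH].
- by rewrite GRing.addr0 mulg1.
- by rewrite -addn1 PoszD GRing.addrA !int_powerS IH mulgA.
- apply: (mulIg b); rewrite -mulgA -!int_powerS.
  have -> : (x + - (n.+1)%:Z + 1 = x + - n%:Z :> int)%R by lia.
  by have -> : (- (n.+1)%:Z + 1 = - n%:Z :> int)%R by lia.
Qed.

End IntegerPower.

Section SpecialHNNStructure.
Context (F : groupType) (N : normal_subgroup F).

Local Notation FZ := (free_product F infinite_cyclic).

Lemma free_product_inlM : {morph @free_product_inl F infinite_cyclic : x y / x * y}.
Proof.
move=> x y; apply/esym/divg1_eq.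
apply: etrans (_ : coset (normal_closure (@free_product_relators F infinite_cyclic))
                        (free_gen _ * free_gen _ / free_gen _) = 1).
  by rewrite cosetF cosetM.
by apply/coset1P; apply: normal_closure_sub; left; exists x, y.
Qed.

Lemma free_product_inrM : {morph @free_product_inr F infinite_cyclic : x y / x * y}.
Proof.
move=> x y; apply/esym/divg1_eq.
apply: etrans (_ : coset (normal_closure (@free_product_relators F infinite_cyclic))
                        (free_gen _ * free_gen _ / free_gen _) = 1).
  by rewrite cosetF cosetM.
by apply/coset1P; apply: normal_closure_sub; right; exists x, y.
Qed.

(** The presentation through the free product with an infinite cyclic group has
    the universal property, because a homomorphism from the infinite cyclic group
    is an arbitrary choice of the image of its generator. *)
Lemma special_hnn_is_hnn :
  exists (iota : {multiplicative F -> special_hnn N}) (t : special_hnn N),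
    is_hnn (normal_set N) iota t.
Proof.
pose R : set FZ := [set r | exists h : F, normal_set N h /\
     r = hnn_letter F * hnn_base h * (hnn_letter F)^-1 * (hnn_base h)^-1].
have [|iota iotaE] := @morphism_pack F (special_hnn N)
    (fun h => coset (normal_closure R) (hnn_base h)).
  by move=> x y; rewrite -cosetM -free_product_inlM.
exists iota, (coset (normal_closure R) (hnn_letter F)); split.
- move=> c Nc.
  have [_ NJ] := normal_setP (normal_closure R).
  have Rc : R (hnn_letter F * hnn_base c * (hnn_letter F)^-1 * (hnn_base c)^-1).
    by exists c.
  have e : coset (normal_closure R) (hnn_base c * hnn_letter F) =
           coset (normal_closure R) (hnn_letter F * hnn_base c).
    apply/coset_eq.
    have := NJ _ (hnn_base c * hnn_letter F) (normal_closure_sub Rc).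
    by rewrite /conjg !mulgA !mulgVK.
  by move: e; rewrite !cosetM /commute iotaE => ->.
- move=> K sK Ki Kt x; rewrite -(coset_repr x).
  apply: (@presented_generated _ _ [set y | K (coset (normal_closure R) y)]).
    case: sK => K1 KF; split=> // y z Ky Kz /=.
    by rewrite cosetF; exact: KF.
  case=> [a|z] /=; first by have := Ki a; rewrite iotaE.
  rewrite -/(free_product_inr F (z : infinite_cyclic)).
  have [|g gE] := @morphism_pack infinite_cyclic FZ (@free_product_inr F _).
    exact: free_product_inrM.
  rewrite -gE.
  have gS (y : int) : g (y + 1)%R = g y * hnn_letter F.
    by rewrite -[hnn_letter F]gE -gmulfM.
  have cK y : K (coset (normal_closure R) (g (y + 1)%R)) <->
              K (coset (normal_closure R) (g y)).
    rewrite gS cosetM; split=> Ky.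
      rewrite -[coset _ (g y)](mulgK (coset (normal_closure R) (hnn_letter F))).
      by apply: subgroup_mul => //; exact: subgroup_inv.
    exact: subgroup_mul.
  elim/int_ind: (z : int) => [|n IH|n IH].
  + by rewrite (morph1 g) (morph1 (coset _)); case: sK.
  + by rewrite -addn1 PoszD; apply/cK.
  + by apply/cK; have -> : (- (n.+1)%:Z + 1 = - n%:Z :> int)%R by lia.
- move=> B f b fb.
  pose phi (s : (F + infinite_cyclic)%type) : B :=
    match s with inl a => f a | inr z => int_power b z end.
  have [g gE] : exists g : {multiplicative FZ -> B},
      forall s, g (presented_gen (@free_product_relators F infinite_cyclic) s)
                = phi s.
    apply: presented_lift.
    move=> k kE r [[x [y ->]]|[x [y ->]]]; rewrite morphF gmulfM !kE /=.
      by rewrite gmulfM mulgV.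
    by rewrite int_powerM mulgV.
  have gR r : R r -> g r = 1.
    move=> [c [Nc ->]]; rewrite !(gmulfM, morphV).
    have -> : g (hnn_base c) = f c by exact: gE.
    have -> : g (hnn_letter F) = b by rewrite /hnn_letter /free_product_inr gE.
    by rewrite fb // mulgK mulgV.
  have [q qE] := quotient_lift (normal_closure_kernel gR).
  exists q; split=> [h|]; rewrite ?iotaE qE; first exact: gE.
  by rewrite /hnn_letter /free_product_inr gE.
Qed.

End SpecialHNNStructure.

(** * Right angled Artin groups and their retractions *)
Section RaagGenerators.
Context (Gamma : simplicial_graph).

Definition raag_gen (u : Gamma) : raag Gamma := presented_gen _ u.

Lemma raag_generated (K : set (raag Gamma)) :
  is_subgroup K -> (forall u, K (raag_gen u)) -> forall x, K x.
Proof. exact: presented_generated. Qed.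

Lemma raag_gen_commute u v : edge u v -> commute (raag_gen u) (raag_gen v).
Proof.
move=> uv; apply/commgP/eqP.
apply: etrans (_ : coset _ [~ free_gen u, free_gen v] = 1).
  by rewrite morphR.
by apply/coset1P; apply: normal_closure_sub; exists u, v.
Qed.

Lemma raag_lift (B : groupType) (phi : Gamma -> B) :
  (forall u v, edge u v -> commute (phi u) (phi v)) ->
  exists g : {multiplicative raag Gamma -> B}, forall u, g (raag_gen u) = phi u.
Proof.
move=> phiC; apply: presented_lift => f fE r [u [v [uv ->]]].
by rewrite morphR !fE; apply/eqP/commgP/phiC.
Qed.

Lemma raag_morph_eq (B : groupType) (f g : {multiplicative raag Gamma -> B}) :
  (forall u, f (raag_gen u) = g (raag_gen u)) -> f =1 g.
Proof. exact: eq_on_generators. Qed.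

Lemma raag_restrict_exists (S : pred Gamma) :
  exists g : {multiplicative raag Gamma -> raag Gamma},
    forall u, g (raag_gen u) = if S u then raag_gen u else 1.
Proof.
apply: raag_lift => u v uv; case: ifP => _; last exact/commute_sym/commute1.
by case: ifP => _; [exact: raag_gen_commute|exact: commute1].
Qed.

(** The retraction onto the subgroup generated by S, taken as an endomorphism:
    the graph stays the same when vertices are deleted one after the other. *)
Definition raag_restrict (S : pred Gamma) :
    {multiplicative raag Gamma -> raag Gamma} :=
  sval (cid (raag_restrict_exists S)).

Lemma raag_restrict_gen S u :
  raag_restrict S (raag_gen u) = if S u then raag_gen u else 1.
Proof. by rewrite /raag_restrict; case: cid. Qed.

Lemma raag_restrict_comp S S' x :
  raag_restrict S (raag_restrict S' x) = raag_restrict (predI S S') x.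
Proof.
have [f fE] := @morphism_pack _ _ (raag_restrict S \o raag_restrict S')
  ltac:(by move=> y z /=; rewrite !gmulfM).
rewrite -[LHS]fE; apply: raag_morph_eq => u; rewrite fE /= !raag_restrict_gen /=.
by case: (S' u); rewrite ?raag_restrict_gen ?morph1 ?andbT ?andbF.
Qed.

Lemma raag_restrict_all (S : pred Gamma) x :
  (forall u, S u) -> raag_restrict S x = x.
Proof.
move=> S1; have [f fE] :=
  @morphism_pack (raag Gamma) (raag Gamma) id (fun _ _ => erefl).
rewrite -[RHS]fE; apply: raag_morph_eq => u.
by rewrite fE raag_restrict_gen S1.
Qed.

Lemma raag_restrict_none (S : pred Gamma) x :
  (forall u, ~~ S u) -> raag_restrict S x = 1.
Proof.
move=> S0; have [f fE] := @morphism_pack (raag Gamma) (raag Gamma) (fun=> 1)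
  ltac:(by move=> y z; rewrite mulg1).
rewrite -[RHS](fE x); apply: raag_morph_eq => u.
by rewrite fE raag_restrict_gen (negbTE (S0 u)).
Qed.

Lemma raag_restrict_eq (S S' : pred Gamma) :
  S =1 S' -> raag_restrict S =1 raag_restrict S'.
Proof. by move=> SS'; apply: raag_morph_eq => u; rewrite !raag_restrict_gen SS'. Qed.

(** If m is conjugate to its image under each single deletion, then the same holds
    for successive deletions, as these carry conjugates to conjugates. Once all
    vertices are deleted, the image is 1. *)
Lemma raag_conj_restrictions_trivial (m : raag Gamma) :
  (forall v, exists y, m ^ y = raag_restrict (predC1 v) m) -> m = 1.
Proof.
move=> mC.
suff [y my] : exists y, m ^ y = raag_restrict (fun u => u \notin enum Gamma) m.
  apply/eqP; rewrite -(conjg_eq1 m y) my; apply/eqP/raag_restrict_none => u.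
  by rewrite negbK mem_enum.
elim: (enum Gamma) => [|v s [y my]].
  by exists 1; rewrite conjg1 raag_restrict_all.
have [z mz] := mC v; exists (z * raag_restrict (predC1 v) y).
rewrite conjgM mz -morphJ my raag_restrict_comp; apply: raag_restrict_eq => u.
by rewrite /= in_cons negb_or.
Qed.

End RaagGenerators.

Definition generated (G : groupType) (A : set G) : set G :=
  [set x | forall K, is_subgroup K -> A `<=` K -> K x].

Lemma generated_subgroup (G : groupType) (A : set G) : is_subgroup (generated A).
Proof.
split=> [K [] //|x y gx gy K sK AK].
by case: (sK) => _; apply; [exact: gx|exact: gy].
Qed.

Lemma generated_gen (G : groupType) (A : set G) : A `<=` generated A.
Proof. by move=> x Ax K _; exact. Qed.

Definition link_group (Gamma0 Gamma : simplicial_graph) (j : Gamma0 -> Gamma)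
    (t : Gamma) : set (raag Gamma0) :=
  generated [set x | exists u, edge (j u) t /\ x = raag_gen u].

(** The defining relations that involve t say exactly that t commutes with its
    neighbours. The graph Gamma0 is identified with Gamma minus t through j and k
    rather than taken as a subgraph, so that the lemma covers both the deletion
    and the addition of a vertex. *)
Lemma raag_is_hnn (Gamma0 Gamma : simplicial_graph) (j : Gamma0 -> Gamma)
    (t : Gamma) (k : Gamma -> option Gamma0) :
  (forall u v, edge (j u) (j v) = edge u v) ->
  k t = None -> (forall u, k (j u) = Some u) ->
  (forall w, w = if k w is Some u then j u else t) ->
  exists iota : {multiplicative raag Gamma0 -> raag Gamma},
    (forall u, iota (raag_gen u) = raag_gen (j u)) /\
    is_hnn (link_group j t) iota (raag_gen t).
Proof.
move=> jE kt kj wE.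
have [|iota iE] := @raag_lift Gamma0 _ (fun u => raag_gen (j u)).
  by move=> u v uv; apply: raag_gen_commute; rewrite jE.
exists iota; split=> //; split.
- move=> c Cc.
  apply: (Cc [set x | commute (raag_gen t) (iota x)]) => [|_ [u [ut ->]]].
    split=> [|x y /= cx cy]; first by rewrite /= morph1; exact: commute1.
    by rewrite /= morphF; apply: commuteM => //; exact: commuteV.
  by rewrite /= iE; apply/raag_gen_commute; rewrite edge_sym.
- move=> K sK Ki Kt; apply: raag_generated => // w; rewrite (wE w).
  by case: (k w) => // u; rewrite -iE.
- move=> B f b fb; have gj u : edge (j u) t -> commute b (f (raag_gen u)).
    by move=> ut; apply: fb; apply: generated_gen; exists u.
  have [|g gE] := @raag_lift Gamma B
    (fun w => if k w is Some u then f (raag_gen u) else b).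
    move=> w w'; rewrite (wE w) (wE w'); case: (k w) => [u|]; case: (k w') => [u'|].
    + by rewrite !kj jE => /raag_gen_commute/(gmulf_commute f).
    + by rewrite kj kt => /gj/commute_sym.
    + by rewrite kj kt edge_sym => /gj.
    + by rewrite edge_irrefl.
  exists g; split; last by rewrite gE kt.
  move=> h; have [f' f'E] := @morphism_pack _ _ (g \o iota)
    ltac:(by move=> y z /=; rewrite !gmulfM).
  rewrite -[LHS]f'E; apply: raag_morph_eq => u.
  by rewrite f'E /= iE gE kj.
Qed.

Section DeleteVertex.
Context (Gamma : simplicial_graph) (t : Gamma).

Definition delete_vertex_edge : rel {u : Gamma | u != t} :=
  fun u v => edge (val u) (val v).

Lemma delete_vertex_sym : symmetric delete_vertex_edge.
Proof. by move=> u v; exact: edge_sym. Qed.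

Lemma delete_vertex_irrefl : irreflexive delete_vertex_edge.
Proof. by move=> u; exact: edge_irrefl. Qed.

Definition delete_vertex : simplicial_graph :=
  SimplicialGraph delete_vertex_sym delete_vertex_irrefl.

Lemma delete_vertex_is_hnn :
  exists iota : {multiplicative raag delete_vertex -> raag Gamma},
    (forall u : delete_vertex, iota (raag_gen u) = raag_gen (val u)) /\
    is_hnn (link_group (val : delete_vertex -> Gamma) t) iota (raag_gen t).
Proof.
pose k (w : Gamma) : option delete_vertex := insub w.
apply: (@raag_is_hnn delete_vertex Gamma val t k) => //; rewrite /k.
- by rewrite insubF ?eqxx.
- by move=> u; rewrite valK.
- by move=> w; case: insubP => [u _ -> //|/negPn/eqP].
Qed.

(** Deleting t is the retraction of the HNN extension onto its base. An element
    conjugate into the base is conjugate to its own image under this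
    retraction, which gives the first hypothesis its form. *)
Lemma raag_centralizer_abelian (n x y : raag Gamma) :
  (forall z, n ^ z <> raag_restrict (predC1 t) n) ->
  commute x n -> commute y n ->
  raag_restrict (predC1 t) x = 1 -> raag_restrict (predC1 t) y = 1 ->
  commute x y.
Proof.
have [iota [iE hE]] := delete_vertex_is_hnn.
have iK := hnn_retract_base hE; set rho := hnn_retract hE in iK.
have killE z : raag_restrict (predC1 t) z = iota (rho z).
  have [f fE] := @morphism_pack _ _ (iota \o rho)
    ltac:(by move=> a b /=; rewrite !gmulfM).
  rewrite -[RHS]fE; apply: raag_morph_eq => u; rewrite fE raag_restrict_gen /=.
  have [->|ut] := eqVneq u t; first by rewrite (hnn_retract_stable hE) morph1.
  by rewrite -[u]/(val (Sub u ut : delete_vertex)) -iE iK.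
have rho1 z : raag_restrict (predC1 t) z = 1 -> rho z = 1.
  by rewrite killE => /(congr1 rho); rewrite iK morph1.
move=> nz xn yn /rho1 rx /rho1 ry.
apply: (hnn_centralizer_abelian (generated_subgroup _) (hE := hE) (n := n)) => //.
move=> z h nzh; apply: (nz (z * (raag_restrict (predC1 t) z)^-1)).
rewrite conjgM nzh -[h]iK -killE -nzh morphJ -conjgM mulgV conjg1 //.
Qed.

End DeleteVertex.

(** * Embedding the HNN extension into a right angled Artin group *)
Section GraphJoin.
Context (Gamma1 Gamma2 : simplicial_graph).

Definition join_edge : rel (Gamma1 + Gamma2)%type := fun x y =>
  match x, y with
  | inl u, inl v => edge u v
  | inr u, inr v => edge u v
  | _, _ => true
  end.

Lemma join_edge_sym : symmetric join_edge.
Proof. by move=> [u|u] [v|v] //=; exact: edge_sym. Qed.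

Lemma join_edge_irrefl : irreflexive join_edge.
Proof. by move=> [u|u] //=; exact: edge_irrefl. Qed.

Definition graph_join : simplicial_graph :=
  SimplicialGraph join_edge_sym join_edge_irrefl.

End GraphJoin.

Section IsolatedVertex.
Context (Gamma : simplicial_graph).

Definition isolated_edge : rel (option Gamma) := fun x y =>
  if (x, y) is (Some u, Some v) then edge u v else false.

Lemma isolated_edge_sym : symmetric isolated_edge.
Proof. by move=> [u|] [v|] //=; exact: edge_sym. Qed.

Lemma isolated_edge_irrefl : irreflexive isolated_edge.
Proof. by move=> [u|] //=; exact: edge_irrefl. Qed.

Definition add_isolated : simplicial_graph :=
  SimplicialGraph isolated_edge_sym isolated_edge_irrefl.

End IsolatedVertex.

Lemma isomorphic_to_subgroupP (G A : groupType) :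
  isomorphic_to_subgroup G A <-> embeds G A.
Proof.
split=> [[S [_ [f [_ finj _]]]]|[f finj]].
  by exists f => x y xy; apply: finj; rewrite ?inE.
exists (range f); split.
  split=> [|_ _ [x _ <-] [y _ <-]]; first by exists 1; rewrite ?morph1.
  by exists (x / y); rewrite ?morphF.
by exists f; split=> [x _|x y _ _|//]; [exists x|exact: finj].
Qed.

(** The two retractions of the Artin group of the join of Gamma1 and Gamma2 onto
    its factors recover phi(x) and psi(xN) from the image of x. The second one
    kills the neighbours of the new vertex, so it detects membership in N; this
    carries reduced words to reduced words. *)
Lemma special_hnn_in_class_A (F : groupType) (N : normal_subgroup F) :
  in_class_A F -> in_class_A (quotient_group N) -> in_class_A (special_hnn N).
Proof.
move=> [Gamma1 /isomorphic_to_subgroupP[phi phi_inj]].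
move=> [Gamma2 /isomorphic_to_subgroupP[psi psi_inj]].
pose Gamma0 := graph_join Gamma1 Gamma2.
pose Gamma := graph_join Gamma1 (add_isolated Gamma2).
exists Gamma; apply/isomorphic_to_subgroupP.
have [a aE] := @raag_lift Gamma1 (raag Gamma0) (fun u => raag_gen (inl u : Gamma0))
  ltac:(by move=> u v uv; exact: raag_gen_commute).
have [b bE] := @raag_lift Gamma2 (raag Gamma0) (fun u => raag_gen (inr u : Gamma0))
  ltac:(by move=> u v uv; exact: raag_gen_commute).
have ab x y : commute (a x) (b y).
  move: x; apply: raag_generated => [|u].
    split=> [|x x' /= cx cx'].
      by rewrite morph1; exact/commute_sym/commute1.
    rewrite morphF; apply/commute_sym/commuteM; last apply: commuteV;
      exact/commute_sym.
  rewrite aE; move: y; apply: raag_generated => [|v].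
    split=> [|y y' /= cy cy']; first by rewrite morph1; exact: commute1.
    by rewrite morphF; apply: commuteM => //; exact: commuteV.
  by rewrite bE; exact: raag_gen_commute.
have [r1 r1E] := @raag_lift Gamma0 (raag Gamma1)
  (fun w => match w with inl u => raag_gen u | inr _ => 1 end)
  ltac:(by move=> [u|u] [v|v] uv; rewrite /commute ?mulg1 ?mul1g //;
           exact: raag_gen_commute).
have [r2 r2E] := @raag_lift Gamma0 (raag Gamma2)
  (fun w => match w with inr u => raag_gen u | inl _ => 1 end)
  ltac:(by move=> [u|u] [v|v] uv; rewrite /commute ?mulg1 ?mul1g //;
           exact: raag_gen_commute).
have trivial_on (G1 G2 : groupType) (Delta : simplicial_graph)
    (f : {multiplicative raag Delta -> G1}) (g : {multiplicative G1 -> G2}) :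
    (forall u, g (f (raag_gen u)) = 1) -> forall x, g (f x) = 1.
  move=> gf1; apply: raag_generated => //.
  by split=> [|x y /= fx fy] /=; rewrite ?morph1 // !morphF fx fy mulgV.
have r2a : forall x, r2 (a x) = 1.
  by apply: trivial_on => u; rewrite aE; exact: (r2E (inl u)).
have r1b : forall x, r1 (b x) = 1.
  by apply: trivial_on => u; rewrite bE; exact: (r1E (inr u)).
have id_on (Delta : simplicial_graph)
    (f : {multiplicative raag Delta -> raag Gamma0})
    (g : {multiplicative raag Gamma0 -> raag Delta}) :
    (forall u, g (f (raag_gen u)) = raag_gen u) -> forall x, g (f x) = x.
  move=> gf1; apply: raag_generated => //.
  by split=> [|x y /= fx fy] /=; rewrite ?morph1 // !morphF fx fy.
have r2b : forall x, r2 (b x) = x.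
  by apply: id_on => u; rewrite bE; exact: (r2E (inr u)).
have r1a : forall x, r1 (a x) = x.
  by apply: id_on => u; rewrite aE; exact: (r1E (inl u)).
have [|q qE] := @morphism_pack F (raag Gamma0)
  (fun x => a (phi x) * b (psi (coset N x))).
  move=> x y; rewrite cosetM !gmulfM !mulgA; congr (_ * _).
  by rewrite -!mulgA ab.
pose j (w : Gamma0) : Gamma :=
  match w with inl u => inl u | inr u => inr (Some u) end.
pose t : Gamma := inr None.
pose k (w : Gamma) : option Gamma0 :=
  match w with
  | inl u => Some (inl u)
  | inr (Some u) => Some (inr u)
  | inr None => None
  end.
have [iota [iE hE]] : exists iota : {multiplicative raag Gamma0 -> raag Gamma},
    (forall u, iota (raag_gen u) = raag_gen (j u)) /\
    is_hnn (link_group j t) iota (raag_gen t).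
  apply: (@raag_is_hnn Gamma0 Gamma j t k) => //.
  - by case=> u [] v.
  - by case.
  - by case=> [|[]].
have linkN x : link_group j t (q x) -> normal_set N x.
  move=> /(_ [set y | r2 y = 1]) qx; apply/coset1P/psi_inj; rewrite morph1.
  suff : r2 (q x) = 1 by rewrite qE gmulfM r2a r2b mul1g.
  apply: qx; last by move=> _ [[u|u] [ut ->]]; [exact: (r2E (inl u))|].
  by split=> [|y z /= ry rz]; rewrite /= ?morph1 // morphF ry rz mulgV.
have Nlink x : normal_set N x -> link_group j t (q x).
  move=> /coset1P Nx; rewrite qE Nx !morph1 mulg1.
  move: (phi x); apply: raag_generated => [|u].
    have [K1 KF] := @generated_subgroup _
      [set x | exists u, edge (j u) t /\ x = raag_gen u].
    split=> [|y z ay az] /=; first by rewrite morph1.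
    by rewrite morphF; exact: KF.
  by rewrite aE; apply: generated_gen; exists (inl u).
have [iotaG [tG hG]] := special_hnn_is_hnn N.
have [iq iqE] := @morphism_pack _ _ (iota \o q)
  ltac:(by move=> x y /=; rewrite !gmulfM).
have [f [fi ft]] := hnn_lift hG (f := iq) (b := raag_gen t)
  ltac:(by move=> c Nc; rewrite iqE; apply: (hnn_commute hE); exact: Nlink).
exists f; apply: morph_inj => x fx.
have sN : is_subgroup (normal_set N) by have [] := normal_setP N.
have [g [w [xE sw]]] := hnn_reduced_word hG x.
pose w' := [seq (s.1, q s.2) | s <- w].
have [||w0 qg] := @hnn_normal_form _ _ _ _ _ (generated_subgroup _) hE (q g) w'.
- rewrite sorted_map; apply: sub_sorted sw => s s' /=.
  by apply: contra => /asboolP[/linkN Ns e]; apply/asboolP.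
- rewrite -fx xE gmulfM fi iqE; congr (_ * _).
  rewrite /w'; elim: (w) => [|s v IH] /=; first by rewrite morph1.
  rewrite !gmulfM IH fi iqE; congr (_ * _ * _).
  by case: (s.1); rewrite /= ?morphV ft.
- move: w0; rewrite /w' xE; case: (w) => //= _; rewrite mulg1.
  suff -> : g = 1 by rewrite morph1.
  apply: phi_inj; rewrite morph1 -[phi g]r1a.
  by have := congr1 r1 qg; rewrite qE gmulfM r1b mulg1 morph1.
Qed.

(** * Embedding the quotient *)
Section EmbedQuotient.
Context (F G : groupType) (N : normal_subgroup F).
Context (iota : {multiplicative F -> G}) (t : G).
Context (hG : is_hnn (normal_set N) iota t).

Local Notation rho := (hnn_retract hG).

(** Each element of G acts by conjugation on N as its image in F does: this holds
    for F and for the stable letter, which acts trivially. *)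
Lemma hnn_kernel_centralizes x n :
  rho x = 1 -> normal_set N n -> commute x (iota n).
Proof.
move=> rx Nn.
pose K : set G :=
  [set y | forall n, normal_set N n -> iota n ^ y = iota (n ^ rho y)].
have: K x.
  apply: (hnn_generated hG).
  - split=> [m Nm|y z Ky Kz m Nm]; first by rewrite morph1 !conjg1.
    rewrite conjgM Ky // morphF conjgM.
    apply: (canLR (conjgK z)); rewrite Kz.
      by rewrite -[in RHS]conjgM mulVg conjg1.
    by do 2!apply: normalJ.
  - by move=> h m Nm; rewrite hnn_retract_base morphJ.
  - move=> m Nm; rewrite hnn_retract_stable conjg1.
    by apply/conjg_fixP/commgP/commute_sym/(hnn_commute hG).
move=> /(_ n Nn); rewrite rx conjg1 => /conjg_fixP/commgP.
exact: commute_sym.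
Qed.

(** Vertices are deleted one by one, while injectivity on the kernel T of the
    retraction onto F is preserved. As long as some n in N survives, there is
    a vertex v that can be deleted: the elements of T lost with v commute with
    each other, and T has no nontrivial abelian subgroup that is normal in G. *)
Lemma restriction_killing_normal_subgroup (Gamma : simplicial_graph)
    (f : {multiplicative G -> raag Gamma}) (h : F) :
  ~ normal_set N h -> injective f ->
  exists S : pred Gamma,
    (forall x, rho x = 1 -> raag_restrict S (f x) = 1 -> x = 1) /\
    (forall n, normal_set N n -> raag_restrict S (f (iota n)) = 1).
Proof.
move=> nNh finj.
have sN : is_subgroup (normal_set N) by have [] := normal_setP N.
have: forall x, rho x = 1 -> raag_restrict (@predT Gamma) (f x) = 1 -> x = 1.
  by move=> x _; rewrite raag_restrict_all // => fx; apply: finj; rewrite morph1.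
move: (@predT Gamma) => S; have [m] := ubnP #|S|; elim: m => // m IH in S *.
move=> Sm Sinj.
have [?|] := pselect (forall n, normal_set N n -> raag_restrict S (f (iota n)) = 1).
  by exists S.
move=> /existsNP[n /not_implyP[Nn fn]].
set p := raag_restrict S (f (iota n)) in fn.
have [v vP] : exists v, forall y, p ^ y <> raag_restrict (predC1 v) p.
  apply: contrapT => nv; apply: fn; apply: raag_conj_restrictions_trivial => v.
  apply: contrapT => nvy; apply: nv; exists v => y yP.
  by apply: nvy; exists y.
have Sv : S v.
  apply: contrapT => /negP nSv; apply: (vP 1); rewrite conjg1 /p raag_restrict_comp.
  apply: raag_restrict_eq => u /=.
  by case: eqVneq => // ->; rewrite (negbTE nSv).
pose S' := predI (predC1 v) S; apply: (IH S').
  rewrite -ltnS; apply: leq_trans Sm; rewrite ltnS.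
  by rewrite (cardD1 v S) [v \in S]Sv add1n ltnS; apply: eq_leq; apply: eq_card.
move=> x rx fx; pose D : set G := [set x | rho x = 1 /\ raag_restrict S' (f x) = 1].
apply: (@hnn_abelian_normal _ _ _ _ _ sN hG h D) => //.
  by move=> y g [ry fy]; split; rewrite !morphJ ?ry ?fy conj1g.
move=> y z [ry fy] [rz fz]; apply/commgP/eqP/Sinj; first by rewrite morphR ry comm1g.
rewrite !morphR; apply/eqP/commgP.
have comp y' :
    raag_restrict (predC1 v) (raag_restrict S (f y')) = raag_restrict S' (f y').
  exact: raag_restrict_comp.
apply: (raag_centralizer_abelian vP); rewrite ?comp //; do 2!apply: gmulf_commute;
  exact: hnn_kernel_centralizes.
Qed.

(** An element x of F killed by the restricted embedding makes the commutator of
    x and t trivial, and only the elements of N commute with t. *)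
Lemma quotient_embeds (Gamma : simplicial_graph) :
  embeds G (raag Gamma) -> embeds (quotient_group N) (raag Gamma).
Proof.
move=> [f finj].
have sN : is_subgroup (normal_set N) by have [] := normal_setP N.
have [allN|/existsNP[h nNh]] := pselect (forall h, normal_set N h).
  have [e eE] := @morphism_pack (quotient_group N) (raag Gamma) (fun=> 1)
    ltac:(by move=> y z; rewrite mulg1).
  exists e; apply: morph_inj => x _; rewrite -(coset_repr x).
  exact/coset1P/allN.
have [S [Sinj SN]] := restriction_killing_normal_subgroup nNh finj.
have [th thE] := @morphism_pack _ _ (raag_restrict S \o f \o iota)
  ltac:(by move=> x y /=; rewrite !gmulfM).
have [|g gE] := @quotient_lift _ _ N th.
  by move=> n Nn; rewrite thE /=; exact: SN.
exists g; apply: morph_inj => w; rewrite -(coset_repr w) gE thE /= => gx.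
apply/coset1P/(hnn_commute_base sN hG)/commgP/eqP/Sinj.
  by rewrite morphR hnn_retract_stable commg1.
by rewrite !morphR gx comm1g.
Qed.

End EmbedQuotient.

Theorem theorem1p2 (F : groupType) (N : normal_subgroup F)
    (hF : in_class_A F) (hFN : in_class_A (quotient_group N)) :
  in_class_A (special_hnn N) /\
  (forall Gamma : simplicial_graph,
     embeds (special_hnn N) (raag Gamma) ->
     embeds (quotient_group N) (raag Gamma)).
Proof.
split; first exact: special_hnn_in_class_A.
move=> Gamma; have [iota [t hG]] := special_hnn_is_hnn N.
exact: (quotient_embeds hG).
Qed.
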